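(* Let $E\subset X$ be a set of finite perimeter and write $u:=\chi_E$. Let $\varepsilon>0$ and let $G\subset X$ be an open set with $\mathrm{Cap}_1(G)<\varepsilon$ such that whenever $y_k\to x$ with $y_k,x\in X\setminus G$, we have $\min_{l_2\in\{1,\ldots,n\}}|u^{l_1}(y_k)-u^{l_2}(x)|\to0$ for each $l_1=1,\ldots,n$. Then \[ \partial_{X\setminus G}\,\mathcal I(E)\subset\partial^*E\setminus G, \] and both $\partial_{X\setminus G}\,\mathcal I(E)$ and $\partial^*E\setminus G$ are closed subsets of $X$.
   Context: Standing assumptions: $(X,d,\mu)$ is a complete metric space with a Borel regular outer measure $\mu$ that is doubling (there is $C_d\ge 1$ with $0<\mu(B(x,2r))\le C_d\,\mu(B(x,r))<\infty$ for all $x\in X$, $r>0$) and supports a $(1,1)$-Poincaré inequality: there are $C_P>0$, $\lambda\ge 1$ such that for every ball $B(x,r)$, every locally integrable $u$ on $X$ and every upper gradient $g$ of $u$, $\frac{1}{\mu(B(x,r))}\int_{B(x,r)}|u-u_{B(x,r)}|\,d\mu\le C_P\, r\,\frac{1}{\mu(B(x,\lambda r))}\int_{B(x,\lambda r)}g\,d\mu$, where $u_B=\frac1{\mu(B)}\int_B u\,d\mu$. A curve is a rectifiable continuous map from a compact interval into $X$, parametrized by arc length. A nonnegative Borel function $g$ is an upper gradient of an extended real-valued function $u$ if $|u(x)-u(y)|\le\int_\gamma g\,ds$ for all curves $\gamma$ with end points $x,y$ (with $|u(x)-u(y)|=\infty$ if at least one of the values is infinite). For $u\in L^1_{\mathrm{loc}}(X)$,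 $\|Du\|(X):=\inf\{\liminf_{i}\int_X g_{u_i}\,d\mu: u_i\in \mathrm{Lip}_{\mathrm{loc}}(X),\ u_i\to u \text{ in } L^1_{\mathrm{loc}}(X)\}$, each $g_{u_i}$ being an upper gradient of $u_i$. A measurable $E\subset X$ is of finite perimeter if $\|D\chi_E\|(X)<\infty$. Capacity: $\|u\|_{N^{1,1}(X)}:=\|u\|_{L^1(X)}+\inf_g\|g\|_{L^1(X)}$, inf over upper gradients $g$ of $u$; $\mathrm{Cap}_1(A):=\inf\|u\|_{N^{1,1}(X)}$ over $u\in N^{1,1}(X)$ (functions with finite norm) with $u\ge 1$ in a neighborhood of $A$. Codimension $1$ Hausdorff measure: $\mathcal H_R(A):=\inf\{\sum_i \mu(B(x_i,r_i))/r_i: A\subset\bigcup_i B(x_i,r_i),\ r_i\le R\}$, $\mathcal H(A):=\lim_{R\to0^+}\mathcal H_R(A)$. Measure theoretic interior and boundary: $\mathcal I(E):=\{x\in X:\lim_{r\to0^+}\mu(B(x,r)\cap E)/\mu(B(x,r))=1\}$; $\partial^*E$ is the set of points at which both $E$ and $X\setminus E$ have positive upper density. For $A,F\subset X$, $\partial_AF$ denotes the boundary of $F\cap A$ in the subspace topology of $A$. The number $\gamma\in(0,1/2]$ is a fixed constant, depending only on $C_d,C_P,\lambda$, such that for every $E\subset X$ of finite perimeter and $\mathcal H$-a.e. $x\in\partial^*E$, $\gamma\le\liminf_{r\to0^+}\frac{\mu(E\cap B(x,r))}{\mu(B(x,r))}\le\limsup_{r\to0^+}\frac{\mu(E\cap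 B(x,r))}{\mu(B(x,r))}\le1-\gamma$ (such $\gamma$ is known to exist). Put $n:=\lfloor 1/\gamma\rfloor$. Approximate limits and jump values: $u^\wedge(x):=\sup\{t\in\overline{\mathbb R}:\lim_{r\to0^+}\frac{\mu(B(x,r)\cap\{u<t\})}{\mu(B(x,r))}=0\}$, $u^\vee(x):=\inf\{t\in\overline{\mathbb R}:\lim_{r\to0^+}\frac{\mu(B(x,r)\cap\{u>t\})}{\mu(B(x,r))}=0\}$; $u^1:=u^\wedge$, $u^n:=u^\vee$, and inductively for $l=2,\ldots,n-1$, $u^l(x):=\sup\{t\in\overline{\mathbb R}:\lim_{r\to0^+}\frac{\mu(B(x,r)\cap\{u^{l-1}(x)+\delta<u<t\})}{\mu(B(x,r))}=0\ \ \forall\,\delta>0\}$ if $u^{l-1}(x)<u^\vee(x)$, and $u^l(x):=u^\vee(x)$ otherwise. *)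

(* Defs.v *)
From HB Require Import structures.
From mathcomp Require Import all_boot all_order all_algebra.
From mathcomp Require Import all_classical all_reals all_analysis.
From mathcomp Require Import measurable_realfun.

Set Implicit Arguments.
Unset Strict Implicit.
Unset Printing Implicit Defensive.

Import Order.TTheory GRing.Theory Num.Theory.
Import numFieldTopology.Exports numFieldNormedType.Exports.

Local Open Scope classical_set_scope.
Local Open Scope ring_scope.

(* MathComp-Analysis has metric spaces and complete uniform spaces but not
   their join. Its complete types are pointed, so that the space is nonempty. *)
#[short(type="completeMetricType")]
HB.structure Definition CompleteMetric (R : numDomainType) :=
  { T of Complete T & Metric R T }.

Section curves.
Context {R : realType} {X : completeMetricType R}.
Implicit Types (c : R -> X) (g u : X -> \bar R).

Definition polygonal_length c (a b : R) (s : seq R) : R :=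
  \sum_(0 <= i < size s) mdist (c (nth b (a :: s) i)) (c (nth b (a :: s) i.+1)).

Definition curve_length c (a b : R) : \bar R :=
  ereal_sup [set (polygonal_length c a b s)%:E | s in itv_partition a b].

(* Curves are nonconstant (0 < l): otherwise the constant curves would forbid
   an upper gradient to every function that takes an infinite value. *)
Definition arc_length_curve (l : R) c :=
  [/\ 0 < l, {within `[0, l], continuous c} &
      forall t, t \in `[0, l] -> curve_length c 0 t = t%:E].

Definition borel : set (set X) := <<s @open X >>.

(* Since +oo - +oo = -oo in \bar R, `|u x - u y| is +oo as soon as u x or u y
   is infinite. *)
Definition upper_gradient u g :=
  [/\ measurable_fun setT (g : g_sigma_algebraType (@open X) -> \bar R),
      forall x, (0 <= g x)%E &
      forall l c, arc_length_curve l c ->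
        (`|u (c 0%R) - u (c l)| <=
         \int[lebesgue_measure]_(t in `[0%R, l]) g (c t))%E].

Definition locally_lipschitz (v : X -> R) := forall x, exists r L : R,
  0 < r /\ forall y z, ball x r y -> ball x r z ->
    `|v y - v z| <= L * mdist y z.

(* The boundary of F `&` A in the subspace topology of A; the points outside A
   are isolated in [subspace A], so that they are never boundary points. *)
Definition boundary_in (A F : set X) : set X :=
  closure (F `&` A : set (subspace A)) `\`
  interior (F `&` A : set (subspace A)).

End curves.

Section outer_measure.
Context {R : realType} {X : completeMetricType R}.
Variable mu : {outer_measure set X -> \bar R}.
Implicit Types (A B E K : set X) (u g : X -> \bar R).

Local Open Scope ereal_scope.

Definition borel_regular :=
  (forall B, borel B -> mu.-caratheodory B) /\
  (forall A, exists B, [/\ borel B, A `<=` B & mu B = mu A]).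

Definition doubling (Cd : R) := forall (x : X) (r : R), (0 < r)%R ->
  [/\ 0 < mu (ball x (2 * r)), mu (ball x (2 * r)) <= Cd%:E * mu (ball x r)
    & Cd%:E * mu (ball x r) < +oo].

(* Integration with respect to the measure that mu induces on the sigma-algebra
   of its Caratheodory-measurable sets. *)
Local Notation nu := (mu : set (caratheodory_type mu) -> \bar R).

Definition mu_measurable u := 
  measurable_fun setT (u : caratheodory_type mu -> \bar R).

(* On a proper space, as here, integrability over compact sets is the same as
   integrability over relatively compact open sets. *)
Definition L1loc u := mu_measurable u /\
  forall K, compact K -> \int[nu]_(x in K) `|u x| < +oo.

Definition cvg_L1loc (v : nat -> X -> R) u := forall K, compact K ->
  \int[nu]_(x in K) `|(v i x)%:E - u x| @[i --> \oo] --> 0.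

Definition mean B u := (\int[nu]_(x in B) u x) / mu B.

Definition poincare11 (CP lam : R) := forall (x : X) (r : R) u g, (0 < r)%R ->
  L1loc u -> upper_gradient u g ->
  mean (ball x r) (fun y => `|u y - mean (ball x r) u|) <=
  (CP * r)%:E * mean (ball x (lam * r)) g.

(* ||Du||(X), as an infimum over sequences of pairs (u_i, g_i) of a function and
   an upper gradient of it. *)
Definition variation_norm u : \bar R :=
  ereal_inf [set limn_einf (fun i => \int[nu]_x (vg i).2 x) |
    vg in [set vg : nat -> (X -> R) * (X -> \bar R) |
      [/\ forall i, locally_lipschitz (vg i).1,
          forall i, upper_gradient (EFin \o (vg i).1) (vg i).2 &
          cvg_L1loc (fun i => (vg i).1) u]]].

Definition chi E : X -> \bar R := EFin \o \1_E.

Definition finite_perimeter E :=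
  mu.-caratheodory E /\ variation_norm (chi E) < +oo.

Definition N11_norm u : \bar R :=
  \int[nu]_x `|u x| +
  ereal_inf [set \int[nu]_x g x | g in upper_gradient u].

Definition Cap1 A : \bar R :=
  ereal_inf [set N11_norm u | u in [set u |
    [/\ mu_measurable u, N11_norm u < +oo &
        exists U, [/\ open U, A `<=` U & forall x, U x -> 1 <= u x]]]].

(* The index set D makes finite coverings admissible. *)
Definition codim1_content (rho : R) A : \bar R :=
  ereal_inf [set s | exists (D : set nat) (x : nat -> X) (r : nat -> R),
    [/\ forall i, D i -> (0 < r i <= rho)%R,
        A `<=` \bigcup_(i in D) ball (x i) (r i) &
        s = \esum_(i in D) (mu (ball (x i) (r i)) / (r i)%:E)]].

Definition codim1_hausdorff A : \bar R :=
  lim (codim1_content rho A @[rho --> 0^'+]).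

Definition density E (x : X) (r : R) : \bar R :=
  mu (ball x r `&` E) / mu (ball x r).

Definition lower_density E x : \bar R := limf_einf (density E x) 0^'+.
Definition upper_density E x : \bar R := limf_esup (density E x) 0^'+.

Definition zero_density E x := density E x r @[r --> 0^'+] --> 0.

Definition mt_interior E : set X :=
  [set x | density E x r @[r --> 0^'+] --> 1].

Definition mt_boundary E : set X :=
  [set x | 0 < upper_density E x /\ 0 < upper_density (~` E) x].

Definition density_bound (gamma : R) := forall E, finite_perimeter E ->
  codim1_hausdorff [set x | mt_boundary E x /\
    ~ [/\ gamma%:E <= lower_density E x,
          lower_density E x <= upper_density E x &
          upper_density E x <= (1 - gamma)%:E]] = 0.

Definition lower_limit u x : \bar R :=
  ereal_sup [set t | zero_density [set y | u y < t] x].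

Definition upper_limit u x : \bar R :=
  ereal_inf [set t | zero_density [set y | t < u y] x].

(* The recursion for the jump values, shifted: [jump_rec u k] is u^(k+1) for
   k+1 < n. *)
Fixpoint jump_rec u (k : nat) (x : X) : \bar R :=
  if k isn't k'.+1 then lower_limit u x
  else if jump_rec u k' x < upper_limit u x then
    ereal_sup [set t | forall delta : R, (0 < delta)%R ->
      zero_density [set y | jump_rec u k' x + delta%:E < u y < t] x]
  else upper_limit u x.

(* u^l for 1 <= l <= n; the value at l = 0 is irrelevant. *)
Definition jump_value (n : nat) u (l : nat) : X -> \bar R :=
  if l == n then upper_limit u else jump_rec u l.-1.

End outer_measure.

(* Main.v *)
Require Import Defs.
From mathcomp Require Import all_boot all_order all_algebra.
From mathcomp Require Import all_classical all_reals all_analysis.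
From mathcomp Require Import measurable_realfun.

Import Order.TTheory GRing.Theory Num.Theory.
Import numFieldTopology.Exports numFieldNormedType.Exports.

Local Open Scope classical_set_scope.
Local Open Scope ring_scope.

(** Let Z(A) be the set of points at which A has zero density. For u the
   indicator function of a measurable set E, exactly three cases occur:
   - on Z(~E), which is the measure theoretic interior of E, both approximate
     limits of u are 1, so that all the jump values u^l are 1;
   - on Z(E), likewise, all the jump values are 0;
   - elsewhere, that is on the measure theoretic boundary, the lower limit is 0
     and the upper limit is 1.
   Suppose that points y_k outside G and outside Z(E) converge to x, also
   outside G. Then u^n(y_k) = 1, so that the quasicontinuity hypothesis gives
   some l with u^l(x) = 1, and x is not in Z(E). With u^1 in place of u^n, the
   same holds for Z(~E). Hence ~G \ Z(E) and ~G \ Z(~E) are closed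
   ([zero_density_avoid_closed]). The measure theoretic boundary outside G is
   their intersection, so it is closed. Finally, as ~G is closed, the boundary
   in ~G of the interior Z(~E) is the intersection of ~G with the closures of
   ~G `&` Z(~E) and of ~G \ Z(~E) ([boundary_inE]), so it is closed as well. The
   first closure is contained in ~G \ Z(E), because Z(E) and Z(~E) are disjoint,
   and the second one in ~G \ Z(~E). *)

(** * Boundaries and closures *)

(** The relative boundary, written with closures in the whole space. *)
Lemma boundary_inE (R : realType) (X : completeMetricType R) (A F : set X) :
  boundary_in A F = closure (F `&` A) `&` closure (A `\` F) `&` A.
Proof.
have sub : F `&` A `<=` A by exact: subIsetr.
rewrite /boundary_in (closure_subspaceW sub).
apply/seteqP; split=> x.
  move=> [[cx Ax] nix]; split=> //; split=> // U Ux.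
  apply: contrapT => UAF; apply: nix.
  apply/(nbhs_subspace_ex _ Ax); exists (U `|` F).
    by apply: filterS Ux; exact: subsetUl.
  rewrite -setIA setIid setIUl; apply/seteqP; split=> [y|y []//]; first by right.
  move=> [Uy Ay]; split=> //.
  by apply: contrapT => nFy; apply: UAF; exists y.
move=> [[cx cAFx] Ax]; split=> //.
move=> /(nbhs_subspace_ex _ Ax)[V Vx]; rewrite -setIA setIid => FV.
have [y [[Ay nFy] Vy]] := cAFx _ Vx.
have : (V `&` A) y by [].
by rewrite -FV => -[].
Qed.

Lemma closure_seq (R : realType) (X : completeMetricType R) (A : set X) x :
  closure A x ->
  exists y : nat -> X, (forall k, A (y k)) /\ y k @[k --> \oo] --> x.
Proof.
move=> Ax.
have /choice[y hy] : forall k : nat, exists z, A z /\ ball x (k.+1%:R^-1 : R) z.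
  move=> k; have [z []] := Ax _ (nbhsx_ballx x (k.+1%:R^-1 : R) ltac:(by [])).
  by exists z.
exists y; split=> [k|]; first by have [] := hy k.
apply/cvg_ballP => e e0; near=> k.
apply: le_ball (hy k).2; apply: ltW.
near: k.
exact: near_infty_natSinv_lt (PosNum e0).
Unshelve. all: by end_near.
Qed.

(** * Limits of nonnegative extended real functions *)

Lemma cvge0_lt {T : Type} (F : set_system T) {FF : Filter F} {R : realType}
    (f : T -> \bar R) (e : R) :
  0 < e -> f x @[x --> F] --> 0%E -> \forall x \near F, (f x < e%:E)%E.
Proof.
move=> e0 /fine_cvgP[ffin f0]; near=> x.
have fx : f x \is a fin_num by near: x.
rewrite -(fineK fx) lte_fin; near: x.
exact: (cvgr_lt 0 f0).
Unshelve. all: by end_near.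
Qed.

Lemma limf_esup_gt0 {T : choiceType} {X : filteredType T} {R : realType}
    (F : set_system X) {FF : ProperFilter F} (f : X -> \bar R) :
  (forall x, 0 <= f x)%E ->
  (0 < limf_esup f F)%E <-> ~ (f x @[x --> F] --> 0%E).
Proof.
move=> f0; rewrite limf_esupE; split=> [|nf].
  rewrite ltNge => /negP h f_0; apply: h.
  apply/lee_addgt0Pr => e e0; rewrite add0e.
  apply: ge_ereal_inf; exists (ereal_sup [set f x | x in [set x | f x < e%:E]%E]).
    by exists [set x | f x < e%:E]%E => //; exact: cvge0_lt.
  by apply: ge_ereal_sup => _ [x /= /ltW fx <-].
rewrite ltNge; apply/negP => sup0; apply: nf.
have lt_e (e : R) : 0 < e -> \forall x \near F, (f x < e%:E)%E.
  move=> e0.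
  have /ereal_inf_lt[_ [V FV <-] Ve] := le_lt_trans sup0 (e0 : (0 < e%:E)%E).
  apply: filterS FV => x Vx; apply: le_lt_trans Ve.
  by apply: ereal_sup_ubound; exists x.
apply/fine_cvgP.
have ffin : \forall x \near F, f x \is a fin_num.
  apply: filterS (lt_e 1 ltr01) => x fx1.
  by rewrite fin_real// (lt_le_trans _ (f0 x))// (lt_trans fx1)// ltry.
split=> //; apply/cvgrPdist_lt => e e0; near=> x.
have fx : f x \is a fin_num by near: x.
rewrite sub0r normrN ger0_norm ?fine_ge0// -lte_fin fineK//.
by near: x; exact: lt_e.
Unshelve. all: by end_near.
Qed.

(** * Density *)

Section zero_density.
Context {R : realType} {X : completeMetricType R}.
Variables (mu : {outer_measure set X -> \bar R}) (Cd : R).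
Hypothesis hdoubling : doubling mu Cd.
Implicit Types (A B : set X) (x : X).
Local Open Scope ereal_scope.

Lemma ball_measure x (r : R) : (0 < r)%R -> 0 < mu (ball x r) < +oo.
Proof.
move=> r0.
have r20 : (0 < r / 2)%R by rewrite divr_gt0.
have [h1 h2 h3] := hdoubling x _ r20.
have e : (2 * (r / 2) = r)%R by rewrite mulrC divfK.
rewrite e in h1 h2.
by rewrite h1 (le_lt_trans h2).
Qed.

Lemma density_ge0 A x r : 0 <= density mu A x r.
Proof. by rewrite mule_ge0 ?inve_ge0 ?outer_measure_ge0. Qed.

Lemma le_density A B x r : A `<=` B -> density mu A x r <= density mu B x r.
Proof.
move=> AB; rewrite lee_wpmul2r ?inve_ge0 ?outer_measure_ge0//.
by apply: le_outer_measure; exact: setIS.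
Qed.

Lemma densityT x (r : R) : (0 < r)%R -> density mu setT x r = 1.
Proof.
move=> r0; have /andP[h1 h2] := ball_measure x _ r0.
by rewrite /density setIT divee ?gt_eqF// fin_real// h2 (lt_trans _ h1).
Qed.

Lemma densityC A x (r : R) : mu.-caratheodory A -> (0 < r)%R ->
  density mu A x r = 1 - density mu (~` A) x r.
Proof.
move=> mA r0; have /andP[h1 h2] := ball_measure x _ r0.
have fB : mu (ball x r) \is a fin_num by rewrite fin_real// h2 (lt_trans _ h1).
have fin C : density mu C x r \is a fin_num.
  rewrite fin_real// (lt_le_trans _ (density_ge0 C x r))//=.
  by rewrite (le_lt_trans (le_density _ setT x r _))// densityT// ltry.
apply/eqP; rewrite eq_sym sube_eq ?fin// ?fin_num_adde_defl ?fin//.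
rewrite /density -ge0_muleDl ?outer_measure_ge0//.
by rewrite -mA divee// gt_eqF.
Qed.

Lemma zero_densityS A B x : A `<=` B ->
  zero_density mu B x -> zero_density mu A x.
Proof.
move=> AB; apply: (squeeze_cvge (f := cst 0)); last exact: cvg_cst.
by near=> r; rewrite density_ge0 le_density.
Unshelve. all: by end_near.
Qed.

Lemma zero_density0 x : zero_density mu set0 x.
Proof.
rewrite /zero_density.
have -> : density mu set0 x = cst 0.
  by apply/funext => r; rewrite /density setI0 outer_measure0 mul0e.
exact: cvg_cst.
Qed.

Lemma zero_densityTF x : ~ zero_density mu setT x.
Proof.
move=> h.
have : density mu setT x r @[r --> 0^'+] --> (1 : \bar R).
  apply: cvg_near_cst; near=> r; apply: densityT.
  by near: r; exact: nbhs_right_gt.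
by move=> /(cvg_unique (@ereal_hausdorff R) h) /eqP; rewrite lt_eqF.
Unshelve. all: by end_near.
Qed.

(** Measurability makes the densities of a set and of its complement add up to
    1 at every scale. *)
Lemma mt_interiorE A x : mu.-caratheodory A ->
  mt_interior mu A x <-> zero_density mu (~` A) x.
Proof.
move=> mA.
have key C (a : \bar R) : mu.-caratheodory C -> a \is a fin_num ->
    density mu (~` C) x r @[r --> 0^'+] --> a ->
    density mu C x r @[r --> 0^'+] --> 1 - a.
  move=> mC fa h.
  have : 1 - density mu (~` C) x r @[r --> 0^'+] --> 1 - a.
    by apply: cvgeB => //; exact: cvg_cst.
  apply: cvg_trans; apply: near_eq_cvg.
  by apply: filterS (nbhs_right_gt 0%R) => r r0; rewrite [RHS]densityC.
split=> h.
  have := key (~` A) 1 (caratheodory_measurable_setC mA) isT.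
  by rewrite setCK subee//; exact.
have := key A 0 mA isT h.
by rewrite sube0.
Qed.

Lemma zero_density_disjoint A x : mu.-caratheodory A ->
  zero_density mu A x -> ~ zero_density mu (~` A) x.
Proof.
move=> mA h /(mt_interiorE _ x mA) /(cvg_unique (@ereal_hausdorff R) h) /eqP.
by rewrite lt_eqF.
Qed.

Lemma upper_density_gt0 A x :
  0 < upper_density mu A x <-> ~ zero_density mu A x.
Proof.
exact: (limf_esup_gt0 _ _ (density_ge0 A x)).
Qed.

Lemma mt_boundaryE A : mt_boundary mu A =
  ~` zero_density mu A `&` ~` zero_density mu (~` A).
Proof.
by apply/seteqP; split=> x [/= /upper_density_gt0 ? /upper_density_gt0 ?].
Qed.

(** * Jump values of an indicator function *)

Lemma lower_limit_chi0 A x :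
  ~ zero_density mu (~` A) x -> lower_limit mu (chi A) x = 0.
Proof.
move=> nA; apply/le_anti/andP; split.
  apply: ge_ereal_sup => t /= zt; rewrite leNgt; apply/negP => t0; apply: nA.
  apply: zero_densityS zt => y /= nAy.
  by rewrite /chi /= indicE memNset.
apply: ereal_sup_ubound => /=.
apply: zero_densityS (zero_density0 x) => y /=.
by rewrite lte_fin ltNge indicE ler0n.
Qed.

Lemma lower_limit_chi1 A x :
  zero_density mu (~` A) x -> lower_limit mu (chi A) x = 1.
Proof.
move=> zA; apply/le_anti/andP; split.
  apply: ge_ereal_sup => t /= zt; rewrite leNgt; apply/negP => t1.
  apply: (@zero_densityTF x).
  apply: zero_densityS zt => y /= _; apply: le_lt_trans t1.
  by rewrite lee_fin indicE; case: (y \in A).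
apply: ereal_sup_ubound => /=.
apply: zero_densityS zA => y /= + Ay.
by rewrite lte_fin indicE mem_set// ltxx.
Qed.

Lemma upper_limit_chi0 A x :
  zero_density mu A x -> upper_limit mu (chi A) x = 0.
Proof.
move=> zA; apply/le_anti/andP; split.
  apply: ereal_inf_lbound => /=.
  apply: zero_densityS zA => y /=; apply: contraPP => nAy.
  by rewrite lte_fin indicE memNset// ltxx.
apply: le_ereal_inf_tmp => t /= zt; rewrite leNgt; apply/negP => t0.
apply: (@zero_densityTF x).
apply: zero_densityS zt => y /= _; apply: (lt_le_trans t0).
by rewrite lee_fin indicE.
Qed.

Lemma upper_limit_chi1 A x :
  ~ zero_density mu A x -> upper_limit mu (chi A) x = 1.
Proof.
move=> nA; apply/le_anti/andP; split.
  apply: ereal_inf_lbound => /=.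
  apply: zero_densityS (zero_density0 x) => y /=.
  by rewrite lte_fin ltNge indicE; case: (y \in A); rewrite ?lexx// ler01.
apply: le_ereal_inf_tmp => t /= zt; rewrite leNgt; apply/negP => t1; apply: nA.
apply: zero_densityS zt => y /= Ay.
by rewrite /chi /= indicE mem_set.
Qed.

(** The recursion for the intermediate jump values stops as soon as the upper
    limit is reached, here at the first step. *)
Lemma jump_value_cst (n l : nat) (u : X -> \bar R) x (c : \bar R) :
  lower_limit mu u x = c -> upper_limit mu u x = c -> jump_value mu n u l x = c.
Proof.
move=> lc uc; rewrite /jump_value; case: ifP => // _.
elim: l.-1 => //= k ->.
by rewrite uc ltxx.
Qed.

(** * Limits of jump values along sequences *)

Variables (n : nat) (E G : set X).
Hypotheses (hn : (1 < n)%N) (hE : mu.-caratheodory E) (hG : open G).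
Hypothesis hquasi : forall (y : nat -> X) (x : X),
  (forall k, (~` G) (y k)) -> (~` G) x -> y k @[k --> \oo] --> x ->
  forall l1 : nat, (1 <= l1 <= n)%N ->
    (\big[mine/+oo]_(1 <= l2 < n.+1)
       `|jump_value mu n (chi E) l1 (y k) - jump_value mu n (chi E) l2 x|)%E
      @[k --> \oo] --> 0%E.

(** If u^l is equal to a along the sequence and every u^l' is equal to b at the
    limit point, then the minimum in the quasicontinuity hypothesis is |a - b|
    for each k, so that |a - b| = 0. *)
Lemma jump_value_limit (y : nat -> X) x (l : nat) (a b : R) :
  (forall k, (~` G) (y k)) -> (~` G) x -> y k @[k --> \oo] --> x ->
  (1 <= l <= n)%N ->
  (forall k, jump_value mu n (chi E) l (y k) = a%:E) ->
  (forall l', jump_value mu n (chi E) l' x = b%:E) -> a = b.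
Proof.
move=> yG xG yx ln ya xb; apply: contrapT => ab.
have d0 : (0 < `|a - b|)%R by rewrite normr_gt0 subr_eq0; exact/eqP.
have [k _ /(_ _ (leqnn k))] := cvge0_lt _ _ _ d0 (hquasi _ _ yG xG yx _ ln).
rewrite /= ltNge => /negP; apply.
by apply: le_bigmin => [|l' _]; rewrite ?leey// ya xb.
Qed.

(** For ~G \ Z(E), the sequence is tested with u^n, which is 1 off Z(E); for
    ~G \ Z(~E), with u^1, which is 0 off Z(~E). *)
Lemma zero_density_avoid_closed :
  closed (~` G `&` ~` zero_density mu E) /\
  closed (~` G `&` ~` zero_density mu (~` E)).
Proof.
have cG : closed (~` G) by exact: open_closedC.
have lim (A : set X) x : closure (~` G `&` A) x -> exists y : nat -> X,
    [/\ forall k, (~` G) (y k), forall k, A (y k), (~` G) x &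
      y k @[k --> \oo] --> x].
  move=> cx; have [y [yA yx]] := closure_seq _ _ _ _ cx.
  exists y; split=> // [k|k|]; [by case: (yA k)|by case: (yA k)|].
  by apply: cG; exact: closure_subset cx => z [].
split=> x /lim[y [yG yA xG yx]]; split=> // zx.
- have : (1 = 0 :> R)%R; last by move/eqP; rewrite oner_eq0.
  apply: (@jump_value_limit y x n) => // [|k|l'].
  + by rewrite (ltnW hn) leqnn.
  + by rewrite /jump_value eqxx upper_limit_chi1//; exact: yA.
  + apply: jump_value_cst; last exact: upper_limit_chi0.
    by apply: lower_limit_chi0; exact: zero_density_disjoint.
- have : (0 = 1 :> R)%R; last by move/eqP; rewrite eq_sym oner_eq0.
  apply: (@jump_value_limit y x 1) => // [|k|l'].
  + exact: ltnW.
  + by rewrite /jump_value lt_eqF//= lower_limit_chi0//; exact: yA.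
  + apply: jump_value_cst; first exact: lower_limit_chi1.
    apply: upper_limit_chi1 => zE; exact: zero_density_disjoint hE zE zx.
Qed.

End zero_density.

Theorem proposition6p2 (R : realType) (X : completeMetricType R)
    (mu : {outer_measure set X -> \bar R}) (Cd CP lam : R)
    (hreg : borel_regular mu)
    (hCd : 1 <= Cd) (hdoubling : doubling mu Cd)
    (hCP : 0 < CP) (hlam : 1 <= lam) (hpoincare : poincare11 mu CP lam)
    (gamma : R) (hgamma0 : 0 < gamma) (hgamma1 : gamma <= 1 / 2)
    (hgamma : density_bound mu gamma)
    (n : nat) (hn : n = Num.truncn (1 / gamma))
    (E : set X) (hE : finite_perimeter mu E)
    (eps : R) (heps : 0 < eps)
    (G : set X) (hG : open G) (hcap : (Cap1 mu G < eps%:E)%E)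
    (hquasi : forall (y : nat -> X) (x : X),
      (forall k, (~` G) (y k)) -> (~` G) x -> y k @[k --> \oo] --> x ->
      forall l1 : nat, (1 <= l1 <= n)%N ->
        (\big[mine/+oo]_(1 <= l2 < n.+1)
           `|jump_value mu n (chi E) l1 (y k) - jump_value mu n (chi E) l2 x|)%E
          @[k --> \oo] --> 0%E) :
  [/\ boundary_in (~` G) (mt_interior mu E) `<=` mt_boundary mu E `\` G,
      closed (boundary_in (~` G) (mt_interior mu E)) &
      closed (mt_boundary mu E `\` G)].
Proof.
have mE := hE.1.
(* n >= 2 because gamma <= 1/2, so that u^1 is the lower limit of u. *)
have n2 : (1 < n)%N.
  rewrite hn truncn_gt_nat.
  by rewrite ler_pdivlMr// mulrC -ler_pdivlMr.
have [cE cEC] := zero_density_avoid_closed _ _ hdoubling _ _ _ n2 mE hG hquasi.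
have bE : mt_boundary mu E `\` G =
    (~` G `&` ~` zero_density mu E) `&` (~` G `&` ~` zero_density mu (~` E)).
  by rewrite mt_boundaryE setDE [LHS]setIC setIACA setIid.
have cG : closed (~` G) by exact: open_closedC.
have intE x : mt_interior mu E x <-> zero_density mu (~` E) x.
  exact: (mt_interiorE _ _ hdoubling).
split; last by rewrite bE; exact: closedI.
- rewrite boundary_inE bE => x [[cx cx'] _]; split.
  + apply: cE; apply: closure_subset cx => z [/intE zE Gz]; split=> // zd.
    exact: (zero_density_disjoint _ _ hdoubling _ _ mE zd zE).
  + apply: cEC; apply: closure_subset cx' => z [Gz nz]; split=> // zd.
    by apply: nz; exact/intE.
- rewrite boundary_inE; apply: closedI => //.
  by apply: closedI; exact: closed_closure.
Qed.
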